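(* For $g=\text{const}$, the angle-preserving connection $\{N^k_n,D^k{}_{nm}\}$ of the $\mathcal{FF}^{PD}_g$-space is linear in the dimension $N=2$, i.e. its coefficients $D^k{}_{nm}$ are independent of $y$.
   Context: $M$ is an $N$-dimensional manifold with Riemannian metric $a_{ij}(x)$ and a 1-form $b=b_i(x)y^i$ of unit length, $a_{ij}b^ib^j=1$, $b^i=a^{ij}b_j$. Let $g$ be a scalar with $-2<g<2$ and $h=\sqrt{1-g^2/4}$. Put $v^i=y^i-bb^i$, $r_{mn}=a_{mn}-b_mb_n$, $q=\sqrt{r_{mn}y^my^n}$, $A=b+\frac12gq$, $B=b^2+gbq+q^2$, $f=\arccos(A/\sqrt B)\in[0,\pi]$, $\chi=f/h$, $J=e^{-\frac12g\chi}$. The $\mathcal{FF}^{PD}_g$-Finsleroid metric function is $K(x,y)=\sqrt{B}\,J$, and the $\mathcal{FF}^{PD}_g$-space is $\{M;a_{ij}(x);b_i(x);g(x);K(x,y)\}$. Connection (for $g=\text{const}$, hence $h=\text{const}$): put $\varkappa=\frac1hK^{1-h}$ and $$\zeta^i(x,y)=\bigl[hv^i+(b+\tfrac12gq)b^i\bigr]\frac{J}{\varkappa h},$$ let $(y^m_i)$ be the inverse of the matrix $(\partial\zeta^i/\partial y^m)$, let $a^i{}_{kn}(x)$ be the Christoffel symbols of $a_{ij}$, and set $$N^m_n=-y^m_i\Bigl(\frac{\partial\zeta^i}{\partial x^n}+a^i{}_{kn}\zeta^k\Bigr),\qquad D^k{}_{nm}=-\frac{\partial N^k_n}{\partial y^m}.$$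 The coefficients are considered on the $b$-slit tangent bundle, i.e. for $y\ne0$ not collinear to $b^i(x)$ (so $q\neq0$). Independence of $y$ means $\partial D^k{}_{nm}/\partial y^i=0$ there. *)

(* Defs.v *)
From HB Require Import structures.
From mathcomp Require Import all_boot all_order all_algebra.
From mathcomp Require Import all_classical all_reals all_analysis.

Set Implicit Arguments.
Unset Strict Implicit.
Unset Printing Implicit Defensive.

Import Order.TTheory GRing.Theory Num.Theory.
Import numFieldNormedType.Exports.

Local Open Scope classical_set_scope.
Local Open Scope ring_scope.

Section SmoothFunctions.
Variables (R : realType) (n : nat).

Definition partial (i : 'I_n) (f : 'rV[R]_n -> R) : 'rV[R]_n -> R :=
  fun x => 'D_(delta_mx 0 i) f x.

Fixpoint Ck (k : nat) (U : set 'rV[R]_n) (f : 'rV[R]_n -> R) : Prop :=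
  (forall x, U x -> {for x, continuous f}) /\
  match k with
  | 0%N => True
  | k'.+1 => forall i : 'I_n,
      (forall x, U x -> derivable f x (delta_mx 0 i)) /\ Ck k' U (partial i f)
  end.

Definition smooth_on (U : set 'rV[R]_n) (f : 'rV[R]_n -> R) : Prop :=
  forall k, Ck k U f.

End SmoothFunctions.

(* [of_coord] is the inverse of [coord]; it is meaningful only on the image
   of [chart_dom], and [coord] only on [chart_dom]. *)
Record chart_map (R : realType) (M : topologicalType) (n : nat) := ChartMap {
  chart_dom : set M;
  coord : M -> 'rV[R]_n;
  of_coord : 'rV[R]_n -> M
}.

Section Charts.
Variables (R : realType) (M : topologicalType) (n : nat).
Implicit Types c d : chart_map R M n.

Definition chart_image c : set 'rV[R]_n := coord c @` chart_dom c.

Definition is_chart c : Prop :=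
  [/\ open (chart_dom c), open (chart_image c),
      (forall p, chart_dom c p -> of_coord c (coord c p) = p),
      (forall p, chart_dom c p -> {for p, continuous (coord c)}) &
      (forall x, chart_image c x -> {for x, continuous (of_coord c)})].

Definition overlap c d : set 'rV[R]_n :=
  coord c @` (chart_dom c `&` chart_dom d).

Definition transition c d : 'rV[R]_n -> 'rV[R]_n :=
  fun x => coord d (of_coord c x).

(* d x'^k / d x^m, for x the coordinates of c and x' those of d *)
Definition dtransition c d (k m : 'I_n) : 'rV[R]_n -> R :=
  partial m (fun x => transition c d x 0 k).

End Charts.

Record smooth_manifold (R : realType) (M : topologicalType) (n : nat) :=
  SmoothManifold {
    chart_index : Type;
    chart : chart_index -> chart_map R M n;
    manifold_hausdorff : hausdorff_space M;
    manifold_countable : @second_countable M;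
    chartP : forall i, is_chart (chart i);
    chart_cover : forall p, exists i, chart_dom (chart i) p;
    transition_smooth : forall i j (k : 'I_n),
      smooth_on (overlap (chart i) (chart j))
        (fun x => transition (chart i) (chart j) x 0 k)
  }.

(* Formulas in one coordinate system, for the components a_ij(x), b_i(x) and
   the scalar g(x); the components y^i of a tangent vector form a row. *)
Section LocalFinsleroid.
Variables (R : realType) (n : nat).
Variables (a : 'rV[R]_n -> 'M[R]_n) (b : 'rV[R]_n -> 'rV[R]_n).
Variable (g : 'rV[R]_n -> R).
Implicit Types x y : 'rV[R]_n.

Definition a_up x : 'M[R]_n := invmx (a x).

Definition b_up x : 'rV[R]_n := \row_i \sum_j a_up x i j * b x 0 j.

Definition b_norm2 x : R := \sum_i \sum_j a x i j * b_up x 0 i * b_up x 0 j.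

Definition h_ x : R := Num.sqrt (1 - g x ^+ 2 / 4).

Definition b_form x y : R := \sum_i b x 0 i * y 0 i.

Definition v_ x y : 'rV[R]_n := y - b_form x y *: b_up x.

Definition r_ x (m k : 'I_n) : R := a x m k - b x 0 m * b x 0 k.

Definition q_ x y : R :=
  Num.sqrt (\sum_m \sum_k r_ x m k * y 0 m * y 0 k).

Definition A_ x y : R := b_form x y + 2^-1 * g x * q_ x y.

Definition B_ x y : R :=
  b_form x y ^+ 2 + g x * b_form x y * q_ x y + q_ x y ^+ 2.

Definition f_ x y : R := acos (A_ x y / Num.sqrt (B_ x y)).

Definition chi_ x y : R := f_ x y / h_ x.

Definition J_ x y : R := expR (- (2^-1 * g x * chi_ x y)).

Definition K_ x y : R := Num.sqrt (B_ x y) * J_ x y.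

Definition varkappa x y : R := (h_ x)^-1 * K_ x y `^ (1 - h_ x).

Definition zeta (i : 'I_n) x y : R :=
  (h_ x * v_ x y 0 i + (b_form x y + 2^-1 * g x * q_ x y) * b_up x 0 i)
  * (J_ x y / (varkappa x y * h_ x)).

Definition zeta_y x y : 'M[R]_n :=
  \matrix_(i, m) partial m (fun y' => zeta i x y') y.

(* (y_zeta x y) m i = y^m_i *)
Definition y_zeta x y : 'M[R]_n := invmx (zeta_y x y).

(* a^i_{kl} *)
Definition christoffel (i k l : 'I_n) x : R :=
  2^-1 * \sum_s a_up x i s *
    (partial k (fun z => a z s l) x + partial l (fun z => a z s k) x
     - partial s (fun z => a z k l) x).

(* N^m_l *)
Definition N_ (m l : 'I_n) x y : R :=
  - \sum_i y_zeta x y m i *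
      (partial l (fun x' => zeta i x' y) x
       + \sum_k christoffel i k l x * zeta k x y).

(* D^k_{lm} *)
Definition D_ (k l m : 'I_n) x y : R := - partial m (fun y' => N_ k l x y') y.

Definition b_slit x y : Prop := y != 0 /\ ~ (exists t : R, y = t *: b_up x).

(* [is_derive] also asserts that the partial derivative exists, ruling out
   default values of the total derivation operator. *)
Definition D_independent_of_y (U : set 'rV[R]_n) : Prop :=
  forall x y, U x -> b_slit x y -> forall k l m i : 'I_n,
    is_derive y (delta_mx 0 i) (fun y' => D_ k l m x y') 0.

End LocalFinsleroid.

(* A Riemannian metric, a 1-form and a scalar on a manifold; the first two are
   given by their components in every chart of the atlas, subject to the
   tensor transformation laws. *)
Record FFPD_space (R : realType) (M : topologicalType) (n : nat) := FFPDSpace {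
  base : smooth_manifold R M n;
  metric : chart_index base -> 'rV[R]_n -> 'M[R]_n;
  oneform : chart_index base -> 'rV[R]_n -> 'rV[R]_n;
  gscalar : M -> R;
  metric_smooth : forall c (i j : 'I_n),
    smooth_on (chart_image (chart c)) (fun x => metric c x i j);
  metric_sym : forall c x, chart_image (chart c) x ->
    (metric c x)^T = metric c x;
  metric_pos : forall c x, chart_image (chart c) x ->
    forall y : 'rV[R]_n, y != 0 ->
      0 < \sum_i \sum_j metric c x i j * y 0 i * y 0 j;
  metric_tensor : forall c d x, overlap (chart c) (chart d) x ->
    forall i j : 'I_n, metric c x i j =
      \sum_k \sum_l metric d (transition (chart c) (chart d) x) k l
        * dtransition (chart c) (chart d) k i x
        * dtransition (chart c) (chart d) l j x;
  oneform_smooth : forall c (i : 'I_n),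
    smooth_on (chart_image (chart c)) (fun x => oneform c x 0 i);
  oneform_tensor : forall c d x, overlap (chart c) (chart d) x ->
    forall i : 'I_n, oneform c x 0 i =
      \sum_k oneform d (transition (chart c) (chart d) x) 0 k
        * dtransition (chart c) (chart d) k i x;
  oneform_unit : forall c x, chart_image (chart c) x ->
    b_norm2 (metric c) (oneform c) x = 1;
  gscalar_smooth : forall c : chart_index base,
    smooth_on (chart_image (chart c)) (fun x => gscalar (of_coord (chart c) x));
  gscalar_range : forall p, - 2 < gscalar p < 2
}.

Section Space.
Variables (R : realType) (M : topologicalType) (n : nat).
Variable F : FFPD_space R M n.

Definition gscalar_in (c : chart_index (base F)) : 'rV[R]_n -> R :=
  fun x => gscalar F (of_coord (chart c) x).

(* The coefficients N^k_l, D^k_{lm} are those of the angle-preserving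
   connection only when g is constant. *)
Definition angle_preserving_connection_linear : Prop :=
  forall c : chart_index (base F),
    D_independent_of_y (metric c) (oneform c) (gscalar_in c)
      (chart_image (chart c)).

End Space.

(* Main.v *)
Require Import Defs.
From mathcomp Require Import all_boot all_order all_algebra.
From mathcomp Require Import all_classical all_reals all_analysis.
From mathcomp Require Import ring lra.

(** Choose near each point an orthonormal frame whose first vector is b^i, and let
    (u, w) be the components of y in it; then q = |w|. For constant g the map
    y |-> zeta becomes, in this frame, a fixed map Z of the plane to itself. In the
    coordinates (A, h q) on a half plane w <> 0, the point y has polar radius
    sqrt B and polar angle f, while Z(y) has length K^h and angle f, with
    the sign of w. Hence the infinitesimal rotation of the target lifts
    through Z, up to that sign, to the vector field X which preserves
    K = sqrt B exp (- g f / (2 h)) and moves f at unit speed. Along X the logarithm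
    of sqrt B grows at the constant rate g / (2 h), so X is the field
    p |-> (g / (2 h) + i) p in p = A + i h q: it is linear in y
    ([rotation_planar_jacobian]).

    The covariant derivative of zeta at fixed y consists of the change of
    the frame components of y, which the differential of zeta carries from a vector
    linear in y, and of the rotation of the frame ([zeta_xE]). In dimension two
    every infinitesimal rotation is a multiple of a single one ([spin_skew]), which
    acts on zeta as the rotation above. Applying the inverse of the differential,
    N is linear in y on each of the two half planes w > 0 and w < 0
    ([N_linear]). The linear maps on the two half planes may differ, since
    X involves the sign of w, but the y-derivatives of N are locally
    constant where w is nonzero, that is, off the direction of b^i
    ([frame_D_independent]). *)

Set Implicit Arguments.
Unset Strict Implicit.
Unset Printing Implicit Defensive.

Import Order.TTheory GRing.Theory Num.Theory.
Import numFieldNormedType.Exports.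

Local Open Scope classical_set_scope.
Local Open Scope ring_scope.

(** * Directional derivatives of scalar functions *)

(** A directional derivative only sees the line through the point, where the
    one-variable chain rule applies. *)
Lemma is_derive_comp (R : realType) (V : normedModType R)
    (f : R -> R) (g : V -> R) (x v : V) (df dg : R) :
  is_derive (g x) 1 f df -> is_derive x v g dg ->
  is_derive x v (fun z => f (g z)) (df * dg).
Proof.
move=> Df [gd gE].
have line (k : V -> R) : 'D_v k x = 'D_1 (fun t : R => k (t *: v + x)) 0.
  rewrite /derive; set G1 := (X in X @ _); set G2 := (X in _ = lim (X @ _)).
  suff -> : G1 = G2 by []; apply/funext => t; rewrite /G1 /G2 /=.
  by rewrite addr0 scale0r add0r (mulr1 t : t *: (1 : R) = t).
have Dg : is_derive (0 : R) 1 (fun t : R => g (t *: v + x)) dg.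
  by split; [exact: (derivable1P g x v).1 | rewrite -line].
have Dfg : is_derive (0 : R) 1 (fun t : R => f (g (t *: v + x))) (df * dg).
  apply: (@is_derive1_comp _ f (fun t : R => g (t *: v + x))).
  by rewrite scale0r add0r.
case: Dfg => Dfg Efg; split; last by rewrite line.
exact: (derivable1P (fun z => f (g z)) x v).2.
Qed.

Lemma is_derive_mul (R : realType) (V : normedModType R)
    (f g : V -> R) (x v : V) (df dg : R) :
  is_derive x v f df -> is_derive x v g dg ->
  is_derive x v (fun z => f z * g z) (df * g x + f x * dg).
Proof.
move=> Df Dg; apply: is_derive_eq (is_deriveM Df Dg) _.
rewrite addrC [f x *: dg]/GRing.scale [g x *: df]/GRing.scale /=.
by rewrite [df * _]mulrC.
Qed.

Lemma is_derive_add (R : realType) (V : normedModType R)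
    (f g : V -> R) (x v : V) (df dg : R) :
  is_derive x v f df -> is_derive x v g dg ->
  is_derive x v (fun z => f z + g z) (df + dg).
Proof. by move=> Df Dg; apply: is_deriveD. Qed.

Lemma is_derive_const (R : realType) (V : normedModType R) (c : R) (x v : V) :
  is_derive x v (fun _ => c) 0.
Proof. exact: is_derive_cst. Qed.

Lemma is_derive_scale (R : realType) (V : normedModType R)
    (c : R) (f : V -> R) (x v : V) (df : R) :
  is_derive x v f df -> is_derive x v (fun z => c * f z) (c * df).
Proof. by move=> Df; apply: (is_deriveZ c Df). Qed.

Lemma is_derive_inv (R : realType) (V : normedModType R)
    (f : V -> R) (x v : V) (df : R) :
  f x != 0 -> is_derive x v f df ->
  is_derive x v (fun z => (f z)^-1) (- df / f x ^+ 2).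
Proof.
move=> f0 Df.
have DV : is_derive (f x) 1 (fun t : R => t^-1) (- (f x) ^- 2 *: 1).
  exact: (@is_deriveV _ id).
apply: is_derive_eq (is_derive_comp DV Df) _.
by rewrite [_ *: 1]mulr1 mulNr mulrC mulNr.
Qed.

(** * Vectors and matrices of size two *)

Lemma big_ord2 (R : nmodType) (F : 'I_2 -> R) : \sum_i F i = F 0 + F 1.
Proof. by rewrite !big_ord_recl big_ord0 addr0; congr (_ + F _); apply/val_inj. Qed.

Lemma det2 (R : comNzRingType) (A : 'M[R]_2) :
  \det A = A 0 0 * A 1 1 - A 0 1 * A 1 0.
Proof.
rewrite (expand_det_row _ 0) big_ord2 /cofactor !det_mx11 !mxE /= expr1 expr0.
have -> : lift 0 0 = 1 :> 'I_2 by exact: val_inj.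
have -> : lift 1 0 = 0 :> 'I_2 by exact: val_inj.
by rewrite mul1r mulN1r mulrN.
Qed.

Lemma row2P (R : pzSemiRingType) (u v : 'rV[R]_2) :
  u 0 0 = v 0 0 -> u 0 1 = v 0 1 -> u = v.
Proof.
by move=> e0 e1; apply/rowP => -[[|[|]]] // k; [move: e0|move: e1]; congr (_ = _);
   congr (_ _ _); apply/val_inj.
Qed.

(** * The planar model of the Finsleroid *)

Section PlanarModel.
Variables (R : realType) (g h : R).
Hypothesis h_gt0 : 0 < h.
Hypothesis h_sq : h ^+ 2 = 1 - g ^+ 2 / 4.

(** In these definitions [u] stands for b, [q] for the length of the part of y
    orthogonal to b^i, and [h] for the square root of 1 - g^2/4: [axis] is A,
    [quad] is B, [angle] is f, [damping] is J and [conformal] is the factor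
    J / (varkappa h) of zeta. *)
Definition axis (u q : R) : R := u + 2^-1 * g * q.
Definition quad (u q : R) : R := u ^+ 2 + g * u * q + q ^+ 2.
Definition angle (u q : R) : R := acos (axis u q / Num.sqrt (quad u q)).
Definition damping (u q : R) : R := expR (- (2^-1 * g * (angle u q / h))).
Definition conformal (u q : R) : R :=
  damping u q /
    (h^-1 * (Num.sqrt (quad u q) * damping u q) `^ (1 - h) * h).

(** The map (u, q) -> (A, h q) turns B into the squared Euclidean length, so f is
    the polar angle of the point (A, h q) and the square root of B its radius. *)
Lemma quadE u q : quad u q = axis u q ^+ 2 + (h * q) ^+ 2.
Proof. by rewrite /quad /axis exprMn h_sq; field. Qed.

Lemma quad_gt0 u q : q != 0 -> 0 < quad u q.
Proof.
move=> q0; rewrite quadE ltr_wpDl ?sqr_ge0 // exprn_even_gt0 //=.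
by rewrite mulf_neq0 // gt_eqF.
Qed.

Lemma conformal_gt0 u q : q != 0 -> 0 < conformal u q.
Proof.
move=> q0; have S0 : 0 < Num.sqrt (quad u q) by rewrite sqrtr_gt0 quad_gt0.
rewrite /conformal divr_gt0 ?expR_gt0 // !mulr_gt0 ?invr_gt0 //.
by rewrite powR_gt0 // mulr_gt0 ?expR_gt0.
Qed.

Section Derivative.
Variables (V : normedModType R) (u q : V -> R) (p v : V) (du dq : R).
Hypotheses (u_derive : is_derive p v u du) (q_derive : is_derive p v q dq).
Hypothesis q_gt0 : 0 < q p.

(** Differential of ln (J / (varkappa h)): since
    J / (varkappa h) = exp ((h-1)/2 ln B - (g/2) f), it is
    (h-1)/2 dB/B - (g/2) df. *)
Definition dlog_conformal (u q du dq : R) : R :=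
  ((h - 1) * (axis u q * axis du dq + h ^+ 2 * q * dq)
   - 2^-1 * g * h * (axis u q * dq - q * axis du dq)) / quad u q.

Lemma is_derive_axis :
  is_derive p v (fun z => axis (u z) (q z)) (axis du dq).
Proof. by apply: is_derive_add => //; apply: is_derive_scale. Qed.

Lemma is_derive_quad :
  is_derive p v (fun z => quad (u z) (q z))
    (2 * (axis (u p) (q p) * axis du dq + h ^+ 2 * q p * dq)).
Proof.
have DA := is_derive_axis.
have Dh := is_derive_scale h q_derive.
have E : (fun z => quad (u z) (q z)) =
   (fun z => axis (u z) (q z) * axis (u z) (q z) + (h * q z) * (h * q z)).
  by apply/funext => z; rewrite quadE !expr2.
rewrite E.
refine (is_derive_eq
  (is_derive_add (is_derive_mul DA DA) (is_derive_mul Dh Dh)) _).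
by rewrite expr2; ring.
Qed.

(** The polar angle f of (A, h q) has df = (A d(hq) - hq dA) / B; the sign of
    the arccosine is unambiguous because [0 < q]. *)
Lemma is_derive_angle :
  is_derive p v (fun z => angle (u z) (q z))
    (h * (axis (u p) (q p) * dq - q p * axis du dq) / quad (u p) (q p)).
Proof.
have q0 : q p != 0 by rewrite gt_eqF.
have B0 : 0 < quad (u p) (q p) by exact: quad_gt0.
have S0 : 0 < Num.sqrt (quad (u p) (q p)) by rewrite sqrtr_gt0.
have S2 := sqr_sqrtr (ltW B0).
have DB := is_derive_quad.
have DA := is_derive_axis.
have DS := is_derive_comp (g := fun z => quad (u z) (q z))
  (is_derive1_sqrt B0) DB.
have DV := is_derive_inv (f := fun z => Num.sqrt (quad (u z) (q z)))
  (lt0r_neq0 S0) DS.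
have DQ := is_derive_mul DA DV.
rewrite /= in DQ.
set S := Num.sqrt _ in S0 S2 DQ.
set a := axis (u p) (q p) in DQ *.
have BE : S ^+ 2 = a ^+ 2 + (h * q p) ^+ 2 by rewrite S2 quadE.
have hq : 0 < h * q p by rewrite mulr_gt0.
(* sine of the polar angle, by which the derivative of acos divides *)
have c2 : 1 - (a / S) ^+ 2 = (h * q p / S) ^+ 2.
  have SN0 := lt0r_neq0 S0.
  apply: (mulIf (expf_neq0 2 SN0)).
  rewrite mulrBl mul1r -!exprMn !divfK // BE; ring.
have rng : -1 < a / S < 1.
  rewrite -ltr_norml -(@ltr_pXn2r _ 2) ?nnegrE ?normr_ge0 // expr1n.
  rewrite real_normK ?num_real // -subr_gt0 c2.
  by rewrite exprn_gt0 // divr_gt0.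
have Dacos := is_derive1_acos rng.
apply: is_derive_eq (is_derive_comp
  (g := fun z => axis (u z) (q z) / Num.sqrt (quad (u z) (q z))) Dacos DQ) _.
rewrite c2 sqrtr_sqr ger0_norm ?divr_ge0 ?ltW // -S2.
rewrite /GRing.scale /= !expr2 in BE *.
have SN0 := lt0r_neq0 S0; have hN0 := lt0r_neq0 h_gt0.
transitivity (- (axis du dq * (S * S)
   - a * (a * axis du dq + h * h * q p * dq)) / (h * q p * (S * S))).
  field; rewrite ?SN0 ?hN0 ?q0 //.
rewrite BE; field.
rewrite -!expr2 -?exprMn -?quadE ?q0 ?hN0 //= ?andbT.
have := B0; rewrite quadE -/a => /lt0r_neq0; rewrite exprMn //.
Qed.

Lemma is_derive_conformal :
  is_derive p v (fun z => conformal (u z) (q z))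
    (conformal (u p) (q p) * dlog_conformal (u p) (q p) du dq).
Proof.
have q0 : q p != 0 by rewrite gt_eqF.
have hN0 := lt0r_neq0 h_gt0.
have B0 : 0 < quad (u p) (q p) by exact: quad_gt0.
have S0 : 0 < Num.sqrt (quad (u p) (q p)) by rewrite sqrtr_gt0.
have S2 := sqr_sqrtr (ltW B0).
have DS := is_derive_comp (g := fun z => quad (u z) (q z))
  (is_derive1_sqrt B0) is_derive_quad.
have DJ : is_derive p v (fun z => damping (u z) (q z))
   (damping (u p) (q p) * (- (2^-1 * g / h) *
     (h * (axis (u p) (q p) * dq - q p * axis du dq) / quad (u p) (q p)))).
  have E : (fun z => damping (u z) (q z)) =
      (fun z => expR (- (2^-1 * g / h) * angle (u z) (q z))).
    by apply/funext => z; congr expR; rewrite mulNr -!mulrA [h^-1 * _]mulrC.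
  rewrite E [damping _ _](congr1 (@^~ p) E).
  exact: is_derive_comp (is_derive_expR _) (is_derive_scale _ is_derive_angle).
have J0 : 0 < damping (u p) (q p) by exact: expR_gt0.
have DK := is_derive_mul DS DJ.
have K0 : 0 < Num.sqrt (quad (u p) (q p)) * damping (u p) (q p).
  by rewrite mulr_gt0.
have DW := is_derive_comp
  (g := fun z => Num.sqrt (quad (u z) (q z)) * damping (u z) (q z))
  (is_derive1_powR (1 - h) K0) DK.
have E : (fun z => conformal (u z) (q z)) =
    (fun z => damping (u z) (q z) *
      ((Num.sqrt (quad (u z) (q z)) * damping (u z) (q z)) `^ (1 - h))^-1).
  apply/funext => z; congr (_ * _^-1).
  by rewrite mulrAC mulVf ?mul1r.
have W0 := powR_gt0 (1 - h) K0.
have DC := is_derive_mul DJ (is_derive_inv (f := fun z =>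
  (Num.sqrt (quad (u z) (q z)) * damping (u z) (q z)) `^ (1 - h)) (lt0r_neq0 W0) DW).
rewrite [conformal (u p) _](congr1 (@^~ p) E) E.
apply: is_derive_eq DC _; rewrite /=.
(* K^(1-h-1) = K^(1-h) / K makes everything rational in K^(1-h), J and sqrt B *)
rewrite [X in (1 - h) * X]powRB ?(lt0r_neq0 K0) ?implybT // powRr1 ?ltW //.
rewrite /dlog_conformal.
move: (powR _ _) W0 => W /lt0r_neq0 W0.
move: (damping _ _) J0 => J /lt0r_neq0 J0 in K0 *.
move: (Num.sqrt _) S0 S2 => S /lt0r_neq0 S0 <-.
by field; rewrite ?W0 ?J0 ?S0 ?hN0.
Qed.
End Derivative.

(** The map y |-> zeta in an orthonormal frame whose first vector is b^i: [c 0 1]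
    is the signed component of y along the second vector, hence [q = |c 0 1|],
    while v^i contributes the signed component itself. *)
Definition planar_map (c : 'rV[R]_2) : 'rV[R]_2 :=
  \row_j (conformal (c 0 0) `|c 0 1| *
           (if j == 0 then axis (c 0 0) `|c 0 1| else h * c 0 1)).

Definition planar_differential (c d : 'rV[R]_2) (j : 'I_2) : R :=
  let dq := Num.sg (c 0 1) * d 0 1 in
  let l := dlog_conformal (c 0 0) `|c 0 1| (d 0 0) dq in
  conformal (c 0 0) `|c 0 1| *
    (if j == 0 then axis (d 0 0) dq + axis (c 0 0) `|c 0 1| * l
     else h * (d 0 1 + c 0 1 * l)).

Definition planar_jacobian (c : 'rV[R]_2) : 'M[R]_2 :=
  \matrix_(i, j) planar_differential c (delta_mx 0 i) j.

Lemma mul_planar_jacobian c d j :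
  (d *m planar_jacobian c) 0 j = planar_differential c d j.
Proof.
rewrite mxE big_ord2 !mxE /planar_differential /dlog_conformal /axis !mxE /=.
by case: (j == 0); ring.
Qed.

Lemma is_derive_abs (V : normedModType R) (w : V -> R) (p v : V) (dw : R) :
  w p != 0 -> is_derive p v w dw ->
  is_derive p v (fun z => `|w z|) (Num.sg (w p) * dw).
Proof.
move=> w0 Dw; have w2 : 0 < w p * w p by rewrite -expr2 exprn_even_gt0.
have E : (fun z => `|w z|) = (fun z => Num.sqrt (w z * w z)).
  by apply/funext => z; rewrite -expr2 sqrtr_sqr.
rewrite E; apply: is_derive_eq
  (is_derive_comp (g := fun z => w z * w z) (is_derive1_sqrt w2) (is_derive_mul Dw Dw)) _.
rewrite -expr2 sqrtr_sqr.
have q0 : `|w p| != 0 by rewrite normr_eq0.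
have := numEsg (w p); move: (w p) (Num.sg _) (`|_|) q0 => y s q q0 ->.
by field.
Qed.

Lemma is_derive_planar_map (V : normedModType R) (c : V -> 'rV[R]_2)
    (p v : V) (dc : 'rV[R]_2) :
  c p 0 1 != 0 -> (forall j, is_derive p v (fun z => c z 0 j) (dc 0 j)) ->
  forall j, is_derive p v (fun z => planar_map (c z) 0 j)
              ((dc *m planar_jacobian (c p)) 0 j).
Proof.
move=> w0 Dc j; rewrite mul_planar_jacobian.
have Dq := is_derive_abs (w := fun z => c z 0 1) w0 (Dc 1).
have q0 : 0 < `|c p 0 1| by rewrite normr_gt0.
have DC := is_derive_conformal (q := fun z => `|c z 0 1|) (Dc 0) Dq q0.
have DA := is_derive_axis (Dc 0) Dq.
have E : (fun z => planar_map (c z) 0 j) = (fun z => conformal (c z 0 0) `|c z 0 1| *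
           (if j == 0 then axis (c z 0 0) `|c z 0 1| else h * c z 0 1)).
  by apply/funext => z; rewrite mxE.
rewrite E /planar_differential; case: (j == 0).
  apply: is_derive_eq (is_derive_mul DC DA) _; rewrite /=; ring.
apply: is_derive_eq (is_derive_mul DC (is_derive_scale h (Dc 1))) _; rewrite /=; ring.
Qed.

(** Acting on rows from the right, it sends (c0, c1) to (- c1, c0). *)
Definition rot90 : 'M[R]_2 := delta_mx 0 1 - delta_mx 1 0.

(** Linear vector field whose pushforward by [planar_map] is the infinitesimal
    rotation, on the half plane where the second coordinate has sign [s]. In
    the coordinates (A, h q) it is s times the field of logarithmic spirals along
    which f has unit speed and ln B has speed g/h, hence K is constant. *)
Definition rotation_generator (s : R) : 'M[R]_2 :=
  h^-1 *: (rot90 + (s * g) *: delta_mx 1 1).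

Variant sign_spec : R -> R -> R -> Prop :=
  | SignPos q of 0 < q : sign_spec q 1 q
  | SignNeg q of 0 < q : sign_spec (- q) (-1) q.

Lemma signP w : w != 0 -> sign_spec w (Num.sg w) `|w|.
Proof.
rewrite neq_lt => /orP[w0|w0].
  rewrite ltr0_sg // ltr0_norm // -{1}[w]opprK; apply: SignNeg; by rewrite oppr_gt0.
by rewrite gtr0_sg // gtr0_norm //; apply: SignPos.
Qed.

(** [conformal] is homogeneous of degree h - 1. *)
Lemma dlog_conformal_euler u q : q != 0 -> dlog_conformal u q u q = h - 1.
Proof.
move=> q0; have B0 := lt0r_neq0 (quad_gt0 u q0); rewrite /dlog_conformal.
by apply: (mulIf B0); rewrite divfK // quadE; ring.
Qed.

Lemma dlog_conformal_linear u q du dq :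
  dlog_conformal u q du dq =
    du * dlog_conformal u q 1 0 + dq * dlog_conformal u q 0 1.
Proof. by rewrite /dlog_conformal /axis; ring. Qed.

Lemma axisN du dq : axis (- du) (- dq) = - axis du dq.
Proof. by rewrite /axis; ring. Qed.

Lemma dlog_conformalN u q du dq :
  dlog_conformal u q (- du) (- dq) = - dlog_conformal u q du dq.
Proof. by rewrite /dlog_conformal axisN; ring. Qed.

(** The direction used here and in the next lemma is [rotation_generator] on the
    upper half plane; it moves A + i h q to (g/(2h) + i) (A + i h q). *)
Lemma axis_rotation u q :
  axis (- (h^-1 * q)) (h^-1 * (u + g * q)) = g / (2 * h) * axis u q - h * q.
Proof.
have hN0 := lt0r_neq0 h_gt0; apply: (mulfI hN0).
rewrite [RHS]mulrBr [h * (h * q)]mulrA -expr2 h_sq /axis.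
by field.
Qed.

(** K is constant along this direction, so ln (J / (varkappa h)) varies as
    ln J = - g f / (2 h) with f of unit speed. *)
Lemma dlog_conformal_rotation u q : q != 0 ->
  dlog_conformal u q (- (h^-1 * q)) (h^-1 * (u + g * q)) = - (g / (2 * h)).
Proof.
move=> q0; have B0 := lt0r_neq0 (quad_gt0 u q0); rewrite /dlog_conformal.
have hN0 := lt0r_neq0 h_gt0.
apply: (mulIf B0); rewrite divfK // quadE axis_rotation.
have -> : u + g * q = axis u q + 2^-1 * g * q by rewrite /axis; field.
by move: (axis u q) => A; field.
Qed.

(** The key identity: infinitesimal rotations of zeta lift to vector fields that
    are linear in y. The planar map multiplies K^h, a function of K only, by the
    unit vector of angle f up to sign, and a field that preserves K and
    moves f at unit speed is linear. *)
Lemma rotation_planar_jacobian (c : 'rV[R]_2) : c 0 1 != 0 ->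
  c *m rotation_generator (Num.sg (c 0 1)) *m planar_jacobian c
    = planar_map c *m rot90.
Proof.
move=> w0; have hN0 := lt0r_neq0 h_gt0.
have q0 : `|c 0 1| != 0 by rewrite normr_eq0.
have d0 : (c *m rotation_generator (Num.sg (c 0 1))) 0 0 = - (h^-1 * c 0 1).
  by rewrite mxE big_ord2 !mxE /=; ring.
have d1 : (c *m rotation_generator (Num.sg (c 0 1))) 0 1 =
    h^-1 * (c 0 0 + Num.sg (c 0 1) * g * c 0 1).
  by rewrite mxE big_ord2 !mxE /=; ring.
have rot := dlog_conformal_rotation (c 0 0) q0.
have ax := axis_rotation (c 0 0) `|c 0 1|.
apply: row2P; rewrite mul_planar_jacobian ![in RHS]mxE big_ord2 !mxE;
  rewrite /planar_differential /= d0 d1.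
all: clear d0 d1; move: (conformal _ _) => s.
all: move: (c 0 0) (c 0 1) w0 q0 rot ax => u w /signP-[] q _ q0 rot ax.
(* On the lower half plane, where q = - c 0 1, the direction of
   [dlog_conformal_rotation] appears with the opposite sign. *)
- by rewrite !mul1r rot ax; ring.
- rewrite (_ : -1 * _ = - (h^-1 * (u + g * q))); last by ring.
  rewrite [- (h^-1 * - q)](_ : _ = - - (h^-1 * q)); last by ring.
  by rewrite dlog_conformalN axisN rot ax; ring.
- by rewrite !mul1r rot /axis; field.
rewrite (_ : -1 * (_ * _) = - (h^-1 * (u + g * q))); last by ring.
rewrite [- (h^-1 * - q)](_ : _ = - - (h^-1 * q)); last by ring.
rewrite dlog_conformalN rot /axis.
by field.
Qed.

(** Nondegeneracy off the axis, so that the inverse matrix in the connection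
    is a true inverse. Homogeneity is what collapses the determinant to a
    monomial. *)
Lemma det_planar_jacobian (c : 'rV[R]_2) : c 0 1 != 0 ->
  \det (planar_jacobian c) = (h * conformal (c 0 0) `|c 0 1|) ^+ 2.
Proof.
move=> w0; rewrite det2 !mxE /planar_differential !mxE /=.
have q0 : `|c 0 1| != 0 by rewrite normr_eq0.
have := dlog_conformal_euler (c 0 0) q0; rewrite !mulr1 !mulr0.
rewrite dlog_conformal_linear (dlog_conformal_linear _ _ 0 (Num.sg _)).
move: (conformal _ _) (dlog_conformal _ _ 1 0) (dlog_conformal _ _ 0 1) => s.
rewrite /axis.
move: (c 0 0) (c 0 1) w0 {q0} => u w /signP-[] q _ Lu Lq eul;
  have -> : h = 1 + (u * Lu + q * Lq) by rewrite eul; ring.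
  ring.
ring.
Qed.

End PlanarModel.

(** * Calculus of matrix-valued functions *)

Lemma mx2P (R : Type) (A B : 'M[R]_2) :
  A 0 0 = B 0 0 -> A 0 1 = B 0 1 -> A 1 0 = B 1 0 -> A 1 1 = B 1 1 -> A = B.
Proof.
have two (i : 'I_2) : i = 0 \/ i = 1.
  by case: i => -[|[|]] // k; [left|right]; apply/val_inj.
by move=> *; apply/matrixP => i j; case: (two i) => ->; case: (two j) => ->.
Qed.

Lemma skew2 (R : realType) (S : 'M[R]_2) : S + S^T = 0 -> S = S 0 1 *: rot90 R.
Proof.
move=> /matrixP E; have e i j := E i j.
have := e 0 0; have := e 0 1; have := e 1 1; rewrite !mxE => e11 e01 e00.
apply: mx2P; rewrite !mxE /=; lra.
Qed.

Lemma is_derive_coord (R : realType) n (y v : 'rV[R]_n) (j : 'I_n) :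
  is_derive y v (fun z => z 0 j) (v 0 j).
Proof.
have /derivable_mxP id_coord := @derivable_id R 'rV[R]_n y v.
split; first exact: id_coord.
by have := @derive_mx R _ _ _ id y v (@derivable_id _ _ _ _);
  rewrite derive_id => /matrixP/(_ 0 j); rewrite mxE.
Qed.

Lemma is_derive_mulmx_const (R : realType) (T : 'M[R]_2) (y v : 'rV[R]_2) j :
  is_derive y v (fun z => (z *m T) 0 j) ((v *m T) 0 j).
Proof.
have E : (fun z : 'rV[R]_2 => (z *m T) 0 j) =
    (fun z => T 0 j * z 0 0 + T 1 j * z 0 1).
  by apply/funext => z; rewrite mxE big_ord2; congr (_ + _); rewrite mulrC.
rewrite E; apply: is_derive_eq
 (is_derive_add (is_derive_scale _ (is_derive_coord y v 0))
                (is_derive_scale _ (is_derive_coord y v 1))) _.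
by rewrite mxE big_ord2; congr (_ + _); rewrite mulrC.
Qed.

Lemma is_derive_mulmx (R : realType) (V : normedModType R) m n
    (A : V -> 'M[R]_(m, 2)) (B : V -> 'M[R]_(2, n)) (x v : V)
    (dA : 'M[R]_(m, 2)) (dB : 'M[R]_(2, n)) :
  (forall i j, is_derive x v (fun z => A z i j) (dA i j)) ->
  (forall i j, is_derive x v (fun z => B z i j) (dB i j)) ->
  forall i j, is_derive x v (fun z => (A z *m B z) i j)
    ((dA *m B x + A x *m dB) i j).
Proof.
move=> DA DB i j.
have E : (fun z => (A z *m B z) i j) =
    (fun z => A z i 0 * B z 0 j + A z i 1 * B z 1 j).
  by apply/funext => z; rewrite mxE big_ord2.
rewrite E; apply: is_derive_eq (is_derive_add
  (is_derive_mul (DA i 0) (DB 0 j)) (is_derive_mul (DA i 1) (DB 1 j))) _.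
by rewrite !mxE !big_ord2 addrACA.
Qed.

(** * The connection in an orthonormal frame *)

(** The columns of [T x] are an orthonormal coframe whose first form is b_i, so
    [y *m T x] lists the frame components of y; the rows of [C x] are the dual
    vectors. *)
Section FrameConnection.
Variables (R : realType) (a : 'rV[R]_2 -> 'M[R]_2) (b : 'rV[R]_2 -> 'rV[R]_2).
Variables (g : R) (U : set 'rV[R]_2).
Let h : R := Num.sqrt (1 - g ^+ 2 / 4).
Let gf : 'rV[R]_2 -> R := fun=> g.
Hypothesis openU : open U.
Hypothesis g_lt2 : -2 < g < 2.
Variables (T C : 'rV[R]_2 -> 'M[R]_2) (dT : 'I_2 -> 'rV[R]_2 -> 'M[R]_2)
   (dC : 'I_2 -> 'rV[R]_2 -> 'M[R]_2).
Hypothesis frame_coframe : forall x, U x -> T x *m C x = 1%:M.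
Hypothesis frame_metric : forall x, U x -> a x = T x *m (T x)^T.
Hypothesis frame_derive : forall x l, U x -> forall i j,
  is_derive x (delta_mx 0 l) (fun z => T z i j) (dT l x i j).
Hypothesis coframe_derive : forall x l, U x -> forall i j,
  is_derive x (delta_mx 0 l) (fun z => C z i j) (dC l x i j).
Hypothesis zetaE : forall i x y, U x ->
  zeta a b gf i x y = (planar_map g h (y *m T x) *m C x) 0 i.

Lemma one_sub_gt0 : 0 < 1 - g ^+ 2 / 4.
Proof.
case/andP: g_lt2 => gN2 g2; have g4 : 0 < (2 - g) * (2 + g).
  by rewrite mulr_gt0; lra.
by rewrite expr2; lra.
Qed.

Lemma h_gt0 : 0 < h.
Proof. by rewrite sqrtr_gt0 one_sub_gt0. Qed.

Lemma h_sq : h ^+ 2 = 1 - g ^+ 2 / 4.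
Proof. by rewrite sqr_sqrtr // ltW // one_sub_gt0. Qed.

Lemma near_domain x : U x -> \forall z \near x, U z.
Proof. by move=> Ux; apply: open_nbhs_nbhs. Qed.

Lemma metric_derive x l i j : U x ->
  is_derive x (delta_mx 0 l) (fun z => a z i j)
    ((dT l x *m (T x)^T + T x *m (dT l x)^T) i j).
Proof.
move=> Ux.
have DTt i' j' : is_derive x (delta_mx 0 l) (fun z => (T z)^T i' j') ((dT l x)^T i' j').
  have E : (fun z => (T z)^T i' j') = (fun z => T z j' i').
    by apply/funext => z; rewrite mxE.
  by rewrite E mxE; apply: frame_derive.
apply: near_eq_is_derive (is_derive_mulmx (frame_derive l Ux) DTt i j).
by near do rewrite frame_metric //; exact: near_domain.
Unshelve. all: by end_near. Qed.

Lemma coframe_deriveE x l : U x -> dT l x *m C x + T x *m dC l x = 0.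
Proof.
move=> Ux; apply/matrixP => i j.
have D1 := is_derive_mulmx (frame_derive l Ux) (coframe_derive l Ux) i j.
have D0 : is_derive x (delta_mx 0 l) (fun z => (T z *m C z) i j) 0.
  apply: near_eq_is_derive (is_derive_const ((1%:M : 'M[R]_2) i j) x _).
  by near do rewrite frame_coframe //; exact: near_domain.
by case: D1 D0 => _ <- [_ ->]; rewrite mxE.
Unshelve. all: by end_near. Qed.

Definition christoffel_mx (l : 'I_2) x : 'M[R]_2 :=
  \matrix_(k, i) christoffel a i k l x.

Lemma frame_unit x : U x -> T x \in unitmx.
Proof. by move=> Ux; case: (mulmx1_unit (frame_coframe Ux)). Qed.

Lemma coframe_frame x : U x -> C x *m T x = 1%:M.
Proof. by move=> /frame_coframe/mulmx1C. Qed.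

Lemma metric_symE x i j : U x -> a x i j = a x j i.
Proof.
move=> Ux; have : (a x)^T = a x by rewrite frame_metric // trmx_mul trmxK.
by move/matrixP/(_ j i); rewrite mxE.
Qed.

Lemma partial_sym x i j k : U x ->
  partial k (fun z => a z i j) x = partial k (fun z => a z j i) x.
Proof.
move=> Ux; apply: near_eq_derive.
by near do rewrite metric_symE //; exact: near_domain.
Unshelve. all: by end_near. Qed.

(** Covariant constancy of the metric, the property of the Christoffel symbols on
    which the linearity rests. *)
Lemma metric_compatible x l : U x ->
  christoffel_mx l x *m a x + (christoffel_mx l x *m a x)^T
   = dT l x *m (T x)^T + T x *m (dT l x)^T.
Proof.
move=> Ux.
have ua : a x \in unitmx.
  by rewrite frame_metric // unitmx_mul unitmx_tr frame_unit.
pose L : 'M[R]_2 := \matrix_(k, s) (2^-1 *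
  (partial k (fun z => a z s l) x + partial l (fun z => a z s k) x
     - partial s (fun z => a z k l) x)).
have aT : (a x)^T = a x by apply/matrixP => i j; rewrite mxE metric_symE.
have -> : christoffel_mx l x = L *m a_up a x.
  have -> : a_up a x = (a_up a x)^T by rewrite /a_up trmx_inv aT.
  by apply/matrixP => k i; rewrite !mxE /christoffel !big_ord2 !mxE; ring.
rewrite -mulmxA mulVmx // mulmx1.
apply/matrixP => i j; have [_ <-] := metric_derive l i j Ux.
rewrite !mxE (partial_sym i l) // (partial_sym j l) // (partial_sym j i) //.
by rewrite /partial; field.
Unshelve. all: by end_near. Qed.

(** Connection matrix of the Levi-Civita connection in the frame: the rows e_0,
    e_1 of [C x] have the covariant derivatives
    nabla_l e_i = sum_j (spin l x i j) e_j. *)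
Definition spin (l : 'I_2) x : 'M[R]_2 :=
  C x *m (christoffel_mx l x *m T x - dT l x).

(** A metric connection is skew in an orthonormal frame, and in dimension two
    the skew matrices are the multiples of a single rotation. *)
Lemma spin_skew x l : U x -> spin l x = spin l x 0 1 *: rot90 R.
Proof.
move=> Ux; apply: skew2.
have uT := frame_unit Ux.
have TC := frame_coframe Ux.
have X : T x *m spin l x *m (T x)^T =
    christoffel_mx l x *m a x - dT l x *m (T x)^T.
  by rewrite /spin mulmxA TC mul1mx mulmxBl -mulmxA -frame_metric.
have key : T x *m (spin l x + (spin l x)^T) *m (T x)^T = 0.
  have -> : T x *m (spin l x + (spin l x)^T) *m (T x)^T =
      T x *m spin l x *m (T x)^T + (T x *m spin l x *m (T x)^T)^T.
    by rewrite mulmxDr mulmxDl !trmx_mul trmxK mulmxA.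
  rewrite X linearB /= addrACA metric_compatible // trmx_mul trmxK -opprD.
  exact: subrr.
have uTt : (T x)^T \in unitmx by rewrite unitmx_tr.
apply: (can_inj (mulKmx uT)); apply: (can_inj (mulmxK uTt)).
by rewrite key mulmx0 mul0mx.
Qed.

(** Matrix of the linear map y |-> N_l on the half plane where the second frame
    component of y has sign [s]. *)
Definition connection_mx (s : R) (l : 'I_2) x : 'M[R]_2 :=
  - ((dT l x + spin l x 0 1 *: (T x *m rotation_generator g h s)) *m C x).

Lemma zeta_yE x y : U x -> (y *m T x) 0 1 != 0 ->
  (zeta_y a b gf x y)^T = T x *m planar_jacobian g h (y *m T x) *m C x.
Proof.
move=> Ux w0; apply/matrixP => m i; rewrite [LHS]mxE [LHS]mxE.
have -> : (fun y' => zeta a b gf i x y') =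
    (fun y' => (planar_map g h (y' *m T x) *m C x) 0 i).
  by apply/funext => y'; exact: zetaE.
have DZ := is_derive_planar_map h_gt0 h_sq (c := fun y' => y' *m T x) (p := y)
  (v := delta_mx 0 m) w0 (is_derive_mulmx_const (T x) y (delta_mx 0 m)).
have [] := @is_derive_mulmx _ _ 1 2 (fun y' => planar_map g h (y' *m T x))
  (fun=> C x) y (delta_mx 0 m)
  (delta_mx 0 m *m T x *m planar_jacobian g h (y *m T x)) 0 _ _ 0 i.
- by move=> k j; rewrite ord1; exact: DZ.
- by move=> k j; rewrite mxE; exact: is_derive_const.
move=> _; rewrite /partial => ->.
by rewrite mulmx0 addr0 -!mulmxA -rowE [LHS]mxE.
Qed.

(** The horizontal derivative of zeta has two sources: the frame components of the
    fixed vector y vary with x, and the frame itself rotates. *)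
Lemma zeta_xE x y l : U x -> (y *m T x) 0 1 != 0 ->
  \row_i (partial l (fun x' => zeta a b gf i x' y) x
       + \sum_k christoffel a i k l x * zeta a b gf k x y) =
  (y *m dT l x *m planar_jacobian g h (y *m T x)
    + planar_map g h (y *m T x) *m spin l x) *m C x.
Proof.
move=> Ux w0; pose Z := planar_map g h (y *m T x).
have dCE : dC l x = - (C x *m dT l x *m C x).
  apply: (can_inj (mulKmx (frame_unit Ux))); apply/eqP.
  rewrite mulmxN -subr_eq0 opprK !mulmxA frame_coframe // mul1mx addrC.
  by rewrite coframe_deriveE.
have spinC : spin l x *m C x = dC l x + C x *m christoffel_mx l x.
  rewrite /spin mulmxBr mulmxBl -!mulmxA frame_coframe // mulmx1 dCE addrC.
  by rewrite !mulmxA.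
rewrite mulmxDl -[X in _ + X]mulmxA spinC mulmxDr addrA.
apply/rowP => i; rewrite [LHS]mxE [RHS]mxE; congr (_ + _).
  have DZ := is_derive_planar_map h_gt0 h_sq (c := fun z => y *m T z) (p := x)
    (v := delta_mx 0 l) (dc := y *m dT l x) w0.
  have DU j : is_derive x (delta_mx 0 l) (fun z => (y *m T z) 0 j) ((y *m dT l x) 0 j).
    have := @is_derive_mulmx _ _ 1 2 (fun=> y) T x (delta_mx 0 l) 0 (dT l x) _
      (frame_derive l Ux) 0 j; rewrite mul0mx add0r; apply.
    by move=> k j'; rewrite mxE; exact: is_derive_const.
  have DP (k : 'I_1) j : is_derive x (delta_mx 0 l)
      (fun z => planar_map g h (y *m T z) k j)
      ((y *m dT l x *m planar_jacobian g h (y *m T x)) k j).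
    by rewrite ord1; apply: DZ; exact: DU.
  have DM := @is_derive_mulmx _ _ 1 2 (fun z => planar_map g h (y *m T z)) C _ _ _ _
    DP (coframe_derive l Ux) 0 i.
  suff /(near_eq_is_derive (g := fun z => zeta a b gf i z y)) /(_ DM) [_ <- //] :
    \near x, (planar_map g h (y *m T x) *m C x) 0 i = zeta a b gf i x y.
  by near do rewrite zetaE //; exact: near_domain.
rewrite mulmxA [RHS]mxE; apply: eq_bigr => k _.
by rewrite zetaE // [christoffel_mx l x k i]mxE mulrC.
Unshelve. all: by end_near. Qed.

(** N_l is minus the preimage, under the y-differential of zeta, of the derivative
    in [zeta_xE]. Its first term is by construction the image of a vector linear
    in y; its second is an infinitesimal rotation of zeta, whose preimage is
    linear by [rotation_planar_jacobian]. *)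
Lemma N_linear x y l m : U x -> (y *m T x) 0 1 != 0 ->
  N_ a b gf m l x y = (y *m connection_mx (Num.sg ((y *m T x) 0 1)) l x) 0 m.
Proof.
move=> Ux w0; set s := Num.sg _.
set J := planar_jacobian g h (y *m T x).
have uT := frame_unit Ux.
have uC : C x \in unitmx by case: (mulmx1_unit (frame_coframe Ux)).
have uJ : J \in unitmx.
  rewrite unitmxE det_planar_jacobian ?h_gt0 ?h_sq // unitfE expf_neq0 //.
  apply: mulf_neq0; apply: lt0r_neq0; first exact: h_gt0.
  by apply: (conformal_gt0 h_gt0 h_sq); rewrite normr_eq0.
pose W := y *m (dT l x + spin l x 0 1 *: (T x *m rotation_generator g h s)) *m C x.
have E : \row_i (partial l (fun x' => zeta a b gf i x' y) x
       + \sum_k christoffel a i k l x * zeta a b gf k x y)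
   = W *m (zeta_y a b gf x y)^T.
  rewrite zeta_xE // zeta_yE // (spin_skew l Ux).
  rewrite -/J /W !mulmxA -(mulmxA _ (C x)) coframe_frame // mulmx1.
  congr (_ *m _); rewrite mulmxDr mulmxDl; congr (_ + _).
  have := rotation_planar_jacobian h_gt0 h_sq w0; rewrite -/s -/J.
  move: (rotation_generator g h s) => X XE.
  by rewrite -!scalemxAr -!scalemxAl mulmxA XE.
have uZ : zeta_y a b gf x y \in unitmx.
  by rewrite -unitmx_tr zeta_yE // !unitmx_mul uT uC andbT.
have -> : y *m connection_mx s l x = - W by rewrite /connection_mx mulmxN mulmxA.
rewrite mxE; congr (- _).
have -> : W = (\row_i (partial l (fun x' => zeta a b gf i x' y) x
       + \sum_k christoffel a i k l x * zeta a b gf k x y)) *m (y_zeta a b gf x y)^T.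
  by rewrite E -mulmxA -trmx_mul mulVmx // trmx1 mulmx1.
by rewrite mxE; apply: eq_bigr => i _; rewrite [RHS]mulrC; congr (_ * _);
   rewrite [RHS]mxE.
Qed.

(** The sign in [connection_mx] is constant near a vector off the axis b^i, so
    there N_l is a single linear map and its y-derivatives are constants. *)
Lemma frame_D_independent :
  (forall x y, U x -> b_slit a b x y -> (y *m T x) 0 1 != 0) ->
  D_independent_of_y a b gf U.
Proof.
move=> slit x y Ux ybs k l m i.
have w0 := slit x y Ux ybs.
pose s := Num.sg ((y *m T x) 0 1).
pose half := [set y' : 'rV[R]_2 | 0 < s * (y' *m T x) 0 1].
have open_half : open half.
  apply: (@open_comp _ _ (fun y' : 'rV[R]_2 => s * (y' *m T x) 0 1) [set r | 0 < r]);
    last exact: open_gt.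
  move=> y' _.
  have -> : (fun z : 'rV[R]_2 => s * (z *m T x) 0 1) =
      (fun z => s * (z 0 0 * T x 0 1 + z 0 1 * T x 1 1)).
    by apply/funext => z; rewrite mxE big_ord2.
  have H j : (fun z : 'rV[R]_2 => z 0 j) @ y' --> y' 0 j by exact: coord_continuous.
  have K (r : R) : (fun _ : 'rV[R]_2 => r) @ y' --> r by exact: (@cst_continuous _ _ r y').
  exact: cvgM (K s) (cvgD (cvgM (H 0) (K (T x 0 1))) (cvgM (H 1) (K (T x 1 1)))).
have half_y : half y by rewrite /half /= -normrEsg normr_gt0.
have half_sg y' : half y' -> (y' *m T x) 0 1 != 0 /\ Num.sg ((y' *m T x) 0 1) = s.
  rewrite /half /s /= neq_lt; move: w0; rewrite neq_lt => /orP[w0|w0].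
    by rewrite ltr0_sg // mulN1r oppr_gt0 => w'0; rewrite w'0 ltr0_sg.
  by rewrite gtr0_sg // mul1r => w'0; rewrite w'0 orbT gtr0_sg.
have near_half y' : half y' -> \forall z \near y', half z.
  by move=> hy'; apply: open_nbhs_nbhs.
have ND y' : half y' -> D_ a b gf k l m x y' = - (connection_mx s l x) m k.
  move=> hy'; rewrite /D_ /partial; congr (- _).
  have := is_derive_mulmx_const (connection_mx s l x) y' (delta_mx 0 m) k.
  rewrite -rowE [(row _ _) _ _]mxE => DL.
  suff /(near_eq_is_derive (g := fun z => N_ a b gf k l x z)) /(_ DL) [_ -> //] :
    \near y', (y' *m connection_mx s l x) 0 k = N_ a b gf k l x y'.
  near=> z; have [|w0' sE] := half_sg z; first by near: z; exact: near_half.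
  by rewrite N_linear // sE.
apply: near_eq_is_derive (is_derive_const (- (connection_mx s l x) m k) y _).
by near=> z; rewrite ND //; near: z; exact: near_half.
Unshelve. all: by end_near. Qed.
End FrameConnection.

(** * The frame adapted to the 1-form *)

Section AdaptedFrame.
Variables (R : realType) (a : 'rV[R]_2 -> 'M[R]_2) (b : 'rV[R]_2 -> 'rV[R]_2).

Definition metric_det (x : 'rV[R]_2) : R := a x 0 0 * a x 1 1 - a x 0 1 * a x 1 0.

(** Components of b^i by Cramer's rule: unlike the inverse matrix, these
    expressions are visibly differentiable in x. *)
Definition sharp0 x : R := (metric_det x)^-1 * (a x 1 1 * b x 0 0 - a x 0 1 * b x 0 1).
Definition sharp1 x : R := (metric_det x)^-1 * (a x 0 0 * b x 0 1 - a x 1 0 * b x 0 0).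

(** The second form of the coframe is the contraction of the area form
    sqrt (det a) dx^0 /\ dx^1 with b^i: a unit form vanishing on b^i. *)
Definition frame x : 'M[R]_2 := \matrix_(i, j)
  (if j == 0 then b x 0 i
   else Num.sqrt (metric_det x) * (if i == 0 then - sharp1 x else sharp0 x)).

Definition coframe x : 'M[R]_2 := \matrix_(i, j)
  (if i == 0 then (if j == 0 then sharp0 x else sharp1 x)
   else (Num.sqrt (metric_det x))^-1 * (if j == 0 then - b x 0 1 else b x 0 0)).

Section AtPoint.
Variable x : 'rV[R]_2.
Hypothesis a_sym : (a x)^T = a x.
Hypothesis a_pos : forall y : 'rV[R]_2, y != 0 ->
  0 < \sum_i \sum_j a x i j * y 0 i * y 0 j.
Hypothesis b_unit : b_norm2 a b x = 1.

Lemma a10 : a x 1 0 = a x 0 1.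
Proof. by rewrite -{1}a_sym mxE. Qed.

Lemma metric_det_gt0 : 0 < metric_det x.
Proof.
pose v (s t : R) : 'rV[R]_2 := \row_j (if j == 0 then s else t).
have Q s t : v s t != 0 ->
   0 < a x 0 0 * s * s + a x 0 1 * s * t + (a x 0 1 * t * s + a x 1 1 * t * t).
  by move/a_pos; rewrite !big_ord2 !mxE /= a10.
have a00 : 0 < a x 0 0.
  have := Q 1 0; rewrite !(mulr1, mulr0, mul0r, addr0); apply.
  by apply/eqP => /rowP/(_ 0)/eqP; rewrite !mxE /= oner_eq0.
have : v (- a x 0 1) (a x 0 0) != 0.
  by apply/eqP => /rowP/(_ 1)/eqP; rewrite !mxE /= gt_eqF.
(* the quadratic form takes at (- a_01, a_00) the value a_00 det a *)
move/Q => P; rewrite -(pmulr_rgt0 _ a00) /metric_det a10.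
by move: P; congr (0 < _); ring.
Qed.

Lemma a_upE : a_up a x = (metric_det x)^-1 *:
  \matrix_(i, j) (if i == j then a x (1 - i) (1 - j) else - a x i j).
Proof.
have G0 := lt0r_neq0 metric_det_gt0.
have ua : a x \in unitmx by rewrite unitmxE det2 unitfE.
apply: (can_inj (mulKmx ua)); rewrite /a_up mulmxV // -scalemxAr.
apply: (scalerI G0); rewrite scalerA divff // scale1r.
apply: mx2P; rewrite !mxE ?big_ord2 ?mxE /= /metric_det ?a10.
all: by rewrite ?subr0 ?subrr; ring.
Qed.

Lemma sharpE : b_up a b x = \row_j (if j == 0 then sharp0 x else sharp1 x).
Proof.
apply: row2P; rewrite !mxE big_ord2 a_upE !mxE /= /sharp0 /sharp1;
  rewrite ?subr0 ?subrr ?a10; ring.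
Qed.

Lemma unit_form_det :
  a x 1 1 * b x 0 0 ^+ 2 - 2 * a x 0 1 * b x 0 0 * b x 0 1
    + a x 0 0 * b x 0 1 ^+ 2 = metric_det x.
Proof.
have G0 := lt0r_neq0 metric_det_gt0; apply: (mulIf (invr_neq0 G0)); rewrite divff //.
rewrite -[RHS]b_unit /b_norm2 !big_ord2 sharpE !mxE /= /sharp0 /sharp1 a10.
move: G0; rewrite /metric_det a10 => G0.
by field.
Qed.

Lemma sharp_unit : sharp0 x * b x 0 0 + sharp1 x * b x 0 1 = 1.
Proof.
have G0 := lt0r_neq0 metric_det_gt0; apply: (mulfI G0).
rewrite mulr1 -[RHS]unit_form_det /sharp0 /sharp1 a10.
by field.
Qed.

Lemma frame_coframeE : frame x *m coframe x = 1%:M.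
Proof.
have S0 : Num.sqrt (metric_det x) != 0 by rewrite lt0r_neq0 // sqrtr_gt0 metric_det_gt0.
have u := sharp_unit.
apply: mx2P; rewrite !mxE !big_ord2 !mxE /= ?mulr1n ?mulr0n -?u;
  move: (Num.sqrt _) S0 => S S0; by field.
Qed.

(** After multiplication by det a, each entry is a multiple of the unit length
    condition in the form [unit_form_det]. *)
Lemma frame_metricE : a x = frame x *m (frame x)^T.
Proof.
have G0 := metric_det_gt0.
have S2 := sqr_sqrtr (ltW G0).
have K := unit_form_det.
have GN0 := lt0r_neq0 G0.
have cross (s t : R) :
    Num.sqrt (metric_det x) * s * (Num.sqrt (metric_det x) * t) =
    metric_det x * s * t.
  by rewrite -{3}S2; ring.
have reduce p X Y : metric_det x *
    (p + metric_det x * ((metric_det x)^-1 * X) * ((metric_det x)^-1 * Y)) =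
    metric_det x * p + X * Y by field.
apply: mx2P; rewrite !mxE !big_ord2 !mxE /= cross /sharp0 /sharp1 ?a10;
  apply: (mulfI GN0); rewrite -{1}K -?mulrN reduce /metric_det a10; ring.
Qed.

Lemma mul_frame0 (y : 'rV[R]_2) : (y *m frame x) 0 0 = b_form b x y.
Proof. by rewrite mxE; apply: eq_bigr => i _; rewrite mxE mulrC. Qed.

Lemma vector_in_frame (y : 'rV[R]_2) :
  y = b_form b x y *: b_up a b x + (y *m frame x) 0 1 *: row 1 (coframe x).
Proof.
have yE : y = y *m frame x *m coframe x by rewrite -mulmxA frame_coframeE mulmx1.
rewrite {1}yE sharpE -mul_frame0; move: (y *m frame x) => c.
by apply/rowP => j; rewrite mxE big_ord2 !mxE.
Qed.

(** In dimension two, r_mn = a_mn - b_m b_n is the square of the second form. *)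
Lemma q_frame (y : 'rV[R]_2) : q_ a b x y = `|(y *m frame x) 0 1|.
Proof.
rewrite -sqrtr_sqr /q_; congr (Num.sqrt _).
have -> : \sum_m \sum_k r_ a b x m k * y 0 m * y 0 k =
   (y *m a x *m y^T) 0 0 - b_form b x y ^+ 2.
  by rewrite /b_form /r_ mxE !big_ord2 !mxE !big_ord2; ring.
rewrite -mul_frame0 frame_metricE mulmxA -mulmxA -trmx_mul.
by move: (y *m frame x) => c; rewrite !mxE big_ord2 !mxE; ring.
Qed.

Lemma zeta_frame g i (y : 'rV[R]_2) :
  zeta a b (fun=> g) i x y =
  (planar_map g (Num.sqrt (1 - g ^+ 2 / 4)) (y *m frame x) *m coframe x) 0 i.
Proof.
have vE : v_ a b x y 0 i = (y *m frame x) 0 1 * coframe x 1 i.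
  by rewrite /v_ {1}(vector_in_frame y) addrC addKr !mxE.
have uE : b_up a b x 0 i = coframe x 0 i by rewrite sharpE !mxE.
have cE : J_ a b (fun=> g) x y / (varkappa a b (fun=> g) x y * h_ (fun=> g) x) =
    conformal g (Num.sqrt (1 - g ^+ 2 / 4)) ((y *m frame x) 0 0) `|(y *m frame x) 0 1|.
  by rewrite mul_frame0 -q_frame.
rewrite /zeta cE vE uE q_frame -mul_frame0 [RHS]mxE big_ord2 !mxE /= /axis /h_; ring.
Qed.

(** A vector without second component is a multiple of b^i. *)
Lemma slit_frame (y : 'rV[R]_2) : b_slit a b x y -> (y *m frame x) 0 1 != 0.
Proof.
move=> [_ slit]; apply/eqP => w0; apply: slit; exists (b_form b x y).
by rewrite {1}(vector_in_frame y) w0 scale0r addr0.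
Qed.

Section Derivable.
Variable v : 'rV[R]_2.
Hypothesis a_derivable : forall i j, derivable (fun z => a z i j) x v.
Hypothesis b_derivable : forall i, derivable (fun z => b z 0 i) x v.

Lemma metric_det_derivable : derivable metric_det x v.
Proof. by apply: derivableB; apply: derivableM. Qed.

Lemma sqrt_metric_det_derivable : derivable (fun z => Num.sqrt (metric_det z)) x v.
Proof.
by have [] := is_derive_comp (g := metric_det)
  (is_derive1_sqrt metric_det_gt0) (derivableP metric_det_derivable).
Qed.

Lemma sharp0_derivable : derivable sharp0 x v.
Proof.
apply: derivableM; first apply: derivableV.
- exact: lt0r_neq0 metric_det_gt0.
- exact: metric_det_derivable.
by apply: derivableB; apply: derivableM.
Qed.

Lemma sharp1_derivable : derivable sharp1 x v.
Proof.
apply: derivableM; first apply: derivableV.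
- exact: lt0r_neq0 metric_det_gt0.
- exact: metric_det_derivable.
by apply: derivableB; apply: derivableM.
Qed.

Lemma frame_derivable i j : derivable (fun z => frame z i j) x v.
Proof.
have -> : (fun z => frame z i j) = (fun z => if j == 0 then b z 0 i
   else Num.sqrt (metric_det z) * (if i == 0 then - sharp1 z else sharp0 z)).
  by apply/funext => z; rewrite mxE.
case: (j == 0) => //; case: (i == 0); apply: derivableM;
  try exact: sqrt_metric_det_derivable.
  by apply: derivableN; exact: sharp1_derivable.
exact: sharp0_derivable.
Qed.

Lemma coframe_derivable i j : derivable (fun z => coframe z i j) x v.
Proof.
have -> : (fun z => coframe z i j) = (fun z =>
  if i == 0 then (if j == 0 then sharp0 z else sharp1 z)
   else (Num.sqrt (metric_det z))^-1 * (if j == 0 then - b z 0 1 else b z 0 0)).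
  by apply/funext => z; rewrite mxE.
case: (i == 0); first case: (j == 0).
- exact: sharp0_derivable.
- exact: sharp1_derivable.
have DS : derivable (fun z => (Num.sqrt (metric_det z))^-1) x v.
  apply: derivableV; last exact: sqrt_metric_det_derivable.
  by rewrite lt0r_neq0 // sqrtr_gt0 metric_det_gt0.
by case: (j == 0); apply: derivableM => //; apply: derivableN.
Qed.
End Derivable.
End AtPoint.
End AdaptedFrame.

(** * Linearity of the angle-preserving connection *)

Theorem theorem2p7 (R : realType) (M : topologicalType)
  (F : FFPD_space R M 2) (g : R)
  (g_const : forall p : M, gscalar F p = g) :
  angle_preserving_connection_linear F.
Proof.
move=> c.
have -> : gscalar_in c = (fun=> g) by apply/funext => x; exact: g_const.
have [_ openU _ _ _] := chartP c.
set a := metric c; set b := oneform c; set U := chart_image (chart c).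
move=> x0 y0 Ux0.
have g2 : -2 < g < 2 by rewrite -(g_const (of_coord (chart c) x0)); exact: gscalar_range.
move: x0 y0 Ux0; rewrite -/(D_independent_of_y a b (fun=> g) U).
have sym x : U x -> (a x)^T = a x.
  by move=> Ux; exact: (Defs.metric_sym Ux).
have pos x : U x -> forall y : 'rV[R]_2, y != 0 ->
    0 < \sum_i \sum_j a x i j * y 0 i * y 0 j.
  by move=> Ux; exact: (metric_pos Ux).
have unit x : U x -> b_norm2 a b x = 1 by move=> Ux; exact: (oneform_unit Ux).
have aD x l i j : U x -> derivable (fun z => a z i j) x (delta_mx 0 l).
  by move=> Ux; have [_ /(_ l)[/(_ x Ux)]] := metric_smooth c i j 1%N.
have bD x l i : U x -> derivable (fun z => b z 0 i) x (delta_mx 0 l).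
  by move=> Ux; have [_ /(_ l)[/(_ x Ux)]] := oneform_smooth c i 1%N.
apply: (@frame_D_independent _ a b g U openU g2 (frame a b) (coframe a b)
  (fun l x => \matrix_(i, j) 'D_(delta_mx 0 l) (fun z => frame a b z i j) x)
  (fun l x => \matrix_(i, j) 'D_(delta_mx 0 l) (fun z => coframe a b z i j) x)).
- by move=> x Ux; apply: frame_coframeE; auto.
- by move=> x Ux; apply: frame_metricE; auto.
- move=> x l Ux i j; rewrite mxE; apply: derivableP; apply: frame_derivable; auto.
- move=> x l Ux i j; rewrite mxE; apply: derivableP; apply: coframe_derivable; auto.
- by move=> i x y Ux; apply: zeta_frame; auto.
- by move=> x y Ux; apply: slit_frame; auto.
Qed.
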